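(* For $p>0$ and $x\in(0,\pi/2)$ let $$\varphi_{p,2}(x) = \frac{\sin x}{x} - \frac{2}{\pi} - p\left(\pi^2 - 4x^2\right).$$ Let $p_1 = \frac{1}{\pi^3} = 0.032251\ldots$ and $p_2 = \frac{\pi-2}{\pi^3} = 0.036818\ldots$. Then: (i) If $p \in (0, p_1]$, then for all $x\in(0,\pi/2)$ $$\frac{\sin x}{x} > \frac{2}{\pi} + p_1\left(\pi^2-4x^2\right) \geq \frac{2}{\pi} + p\left(\pi^2-4x^2\right).$$ (ii) If $p \in (p_1,p_2)$, then the equation $\varphi_{p,2}(x)=0$ has a unique solution $x_0^{(p)}$ in $(0,\pi/2)$, and $$x \in \left(0,x_0^{(p)}\right) \Longrightarrow \frac{\sin x}{x} > \frac{2}{\pi} + p\left(\pi^2-4x^2\right), \qquad x\in\left(x_0^{(p)},\frac{\pi}{2}\right) \Longrightarrow \frac{\sin x}{x} < \frac{2}{\pi}+p\left(\pi^2-4x^2\right).$$ (iii) If $p\in[p_2,+\infty)$, then for all $x\in(0,\pi/2)$ $$\frac{\sin x}{x} < \frac{2}{\pi} + p_2\left(\pi^2-4x^2\right) \leq \frac{2}{\pi}+p\left(\pi^2-4x^2\right).$$ (iv) For each $p\in(p_1,p_2]$, the function $\varphi_{p,2}$ has exactly one minimum on $(0,\pi/2)$, at a point $m^{(p)}\in(0,\pi/2)$. (v) The equation $\left|\varphi_{p,2}(0+)\right| = \left|\varphi_{p,2}\left(m^{(p)}\right)\right|$ has, for the parameter $p\in(p_1,p_2)$, the solution $p=p_0$,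 numerically determined as $p_0 = 0.036014\ldots$. For the value $$d_0 = \left|\varphi_{p_0,2}(0+)\right| = \left|\varphi_{p_0,2}\left(m^{(p_0)}\right)\right| = 0.0079283\ldots$$ it holds $$d_0 = \inf_{p\in(0,\infty)}\ \sup_{x\in(0,\pi/2)} \left|\varphi_{p,2}(x)\right|.$$ Hence the minimax approximant of the family $\varphi_{p,2}$ ($p>0$) is $\varphi_{p_0,2}(x) = \frac{\sin x}{x}-\frac{2}{\pi}-p_0\left(\pi^2-4x^2\right)$, which determines the corresponding minimax approximation $\frac{\sin x}{x}\approx \frac{2}{\pi}+p_0\left(\pi^2-4x^2\right)$.
   Context: ''Minimum'' on the open interval $(0,\pi/2)$ in (iv) means local minimum at an interior point. The notation $f(0+)$ means $\lim_{x\to 0+} f(x)$. Minimax approximant: for a family of functions $\varphi_p(x)$, $x \in (a,b)$, $p \in \mathbb{R}^+ = (0,\infty)$, if the infimum over $p$ of the error $d(p) = \sup_{x\in(a,b)}|\varphi_p(x)|$ is attained at $p = p_0 \in \mathbb{R}^+$, then $\varphi_{p_0}$ is called the minimax approximant of the family on $(a,b)$. A decimal followed by ''$\ldots$'' gives the leading digits of the decimal expansion. *)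

(* Defs.v *)
From Stdlib Require Import Reals.
From Coquelicot Require Import Coquelicot.
Open Scope R_scope.

Definition p1 : R := 1 / PI ^ 3.
Definition p2 : R := (PI - 2) / PI ^ 3.

Definition phi2 (p x : R) : R :=
  sin x / x - 2 / PI - p * (PI ^ 2 - 4 * x ^ 2).

Definition is_local_min (f : R -> R) (x : R) : Prop :=
  locally x (fun y => f x <= f y).

(* [l] is the one-sided limit f(a+). *)
Definition is_right_lim (f : R -> R) (a l : R) : Prop :=
  filterlim f (at_right a) (locally l).

(* The supremum and infimum are taken in [Rbar], so that no boundedness has to
   be assumed for them to be meaningful. *)
Definition sup_error (phi : R -> R -> R) (a b p : R) : Rbar :=
  Lub_Rbar (fun y => exists x, a < x < b /\ y = Rabs (phi p x)).

Definition inf_sup_error (phi : R -> R -> R) (a b : R) : Rbar :=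
  Rbar_glb (fun e => exists p, 0 < p /\ e = sup_error phi a b p).

(* [phi p0] is a minimax approximant of the family [phi p], [p > 0], on (a,b):
   the infimum over the parameters is attained at [p0]. *)
Definition is_minimax_approximant (phi : R -> R -> R) (a b p0 : R) : Prop :=
  0 < p0 /\ sup_error phi a b p0 = inf_sup_error phi a b.

(* Main.v *)
Require Import Defs.
From Stdlib Require Import Reals.
From Coquelicot Require Import Coquelicot.
From Stdlib Require Import Lra ClassicalEpsilon.
Open Scope R_scope.

(** The derivative of [phi2 p] at [x > 0] is [x * (8 * p - profile x)], where
    [profile x = (sin x - x * cos x) / x ^ 3] does not depend on [p] and decreases
    strictly on (0, PI) ([profile_decr]), from the limit 1/3 at 0
    ([profile_near_0]) to [8 * p1] at PI/2.

    For [p <= p1] the function [phi2 p] is therefore decreasing down to its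
    value 0 at PI/2.  For [p1 < p < 1/24], in particular for [p <= p2], it first
    decreases and then increases, turning at the point [m] where
    [profile m = 8 * p]; so its only local minimum is [m], and
    [phi2 p m < 0].  The limit at 0 is [boundary p = PI ^ 2 * (p2 - p)], and its
    sign decides whether the decreasing part starts above or below 0.  This
    gives (i) to (iv).

    For (v), [boundary p] and the minimum value of [phi2 p] both decrease
    strictly with [p] ([boundary_plus_min_decr]), so their sum vanishes for at
    most one [p].  Parametrizing by the minimum point instead of [p], i.e.
    putting [p = profile a / 8], turns this sum into the explicit continuous
    function [balance a], and the intermediate value theorem between two
    decimals gives both the existence of [p0] and its digits
    ([equioscillation]), without any control on how [m] depends on [p].
    At [p0] the error oscillates between [d0] (approached at 0) and [- d0]
    (at the minimum point [a0]).  A smaller [p] raises the limit at 0 above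
    [d0], a larger one pushes the value at [a0] below [- d0]; so every other [p]
    has a strictly larger supremum ([sup_error_equioscillation],
    [sup_error_gt]). *)

(** * Monotonicity and one-sided limits *)

Lemma lt_of_derive_pos (f df : R -> R) (x y : R) :
  x < y ->
  (forall c, x <= c <= y -> is_derive f c (df c)) ->
  (forall c, x < c < y -> 0 < df c) ->
  f x < f y.
Proof.
  intros Hxy Hd Hpos.
  destruct (MVT_cor2 f df x y Hxy) as [c [Hc Hin]].
  { intros c Hc. apply is_derive_Reals, Hd, Hc. }
  specialize (Hpos c Hin).
  assert (0 < df c * (y - x)) by (apply Rmult_lt_0_compat; lra).
  lra.
Qed.

Lemma gt_of_derive_neg (f df : R -> R) (x y : R) :
  x < y ->
  (forall c, x <= c <= y -> is_derive f c (df c)) ->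
  (forall c, x < c < y -> df c < 0) ->
  f y < f x.
Proof.
  intros Hxy Hd Hneg.
  destruct (MVT_cor2 f df x y Hxy) as [c [Hc Hin]].
  { intros c Hc. apply is_derive_Reals, Hd, Hc. }
  specialize (Hneg c Hin).
  assert (0 < - df c * (y - x)) by (apply Rmult_lt_0_compat; lra).
  lra.
Qed.

Lemma IVT_derive (f df : R -> R) (x y : R) :
  x < y ->
  (forall c, x <= c <= y -> is_derive f c (df c)) ->
  f x < 0 -> 0 < f y ->
  exists z, x <= z <= y /\ f z = 0.
Proof.
  intros Hxy Hd Hx Hy.
  destruct (Ranalysis5.IVT_interv f x y) as [z Hz]; [|lra|lra|lra|now exists z].
  intros c Hc. apply derivable_continuous_pt.
  exists (df c). apply is_derive_Reals, Hd, Hc.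
Qed.

Lemma right_lim_witness (f : R -> R) (l d : R) (P : R -> Prop) :
  is_right_lim f 0 l -> 0 < d -> locally l P ->
  exists x, 0 < x < d /\ P (f x).
Proof.
  intros Hf Hd HP.
  destruct (Hf P HP) as [e He].
  exists (Rmin (e / 2) (d / 2)).
  pose proof (cond_pos e) as He0.
  pose proof (Rmin_l (e / 2) (d / 2)). pose proof (Rmin_r (e / 2) (d / 2)).
  assert (0 < Rmin (e / 2) (d / 2)) by (apply Rmin_glb_lt; lra).
  split; [lra|].
  apply He; [|lra].
  change (Rabs (Rmin (e / 2) (d / 2) - 0) < e).
  rewrite Rabs_right; lra.
Qed.

(** * The derivative of the error function *)

(** Eight times the parameter [p] for which [x] is a critical point of
    [phi2 p]. *)
Definition profile (x : R) : R := (sin x - x * cos x) / x ^ 3.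

Lemma xcos_lt_sin (x : R) : 0 < x < PI -> 0 < sin x - x * cos x.
Proof.
  intros Hx.
  replace 0 with (sin 0 - 0 * cos 0) by (rewrite sin_0; ring).
  apply (lt_of_derive_pos (fun x => sin x - x * cos x) (fun x => x * sin x)); [lra| |].
  - intros c _. auto_derive; [trivial|ring].
  - intros c Hc. apply Rmult_lt_0_compat; [|apply sin_gt_0]; lra.
Qed.

(** This is the numerator of the derivative of [profile]; its own derivative is
    [- x * (sin x - x * cos x)]. *)
Lemma profile_derive_num_neg (x : R) :
  0 < x < PI -> (x ^ 2 - 3) * sin x + 3 * x * cos x < 0.
Proof.
  intros Hx.
  replace 0 with ((0 ^ 2 - 3) * sin 0 + 3 * 0 * cos 0) by (rewrite sin_0; ring).
  apply (gt_of_derive_neg (fun x => (x ^ 2 - 3) * sin x + 3 * x * cos x)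
           (fun x => - (x * (sin x - x * cos x)))); [lra| |].
  - intros c _. auto_derive; [trivial|ring].
  - intros c Hc.
    assert (0 < c * (sin c - c * cos c)); [|lra].
    apply Rmult_lt_0_compat; [|apply xcos_lt_sin]; lra.
Qed.

Lemma profile_is_derive (x : R) :
  0 < x -> is_derive profile x (((x ^ 2 - 3) * sin x + 3 * x * cos x) / x ^ 4).
Proof.
  intros Hx. unfold profile. auto_derive.
  - repeat split. apply Rgt_not_eq. change (0 < x ^ 3). now apply pow_lt.
  - field. lra.
Qed.

Lemma profile_decr (x y : R) : 0 < x -> x < y -> y < PI -> profile y < profile x.
Proof.
  intros Hx Hxy Hy.
  apply (gt_of_derive_neg profile
           (fun x => ((x ^ 2 - 3) * sin x + 3 * x * cos x) / x ^ 4)); [lra| |].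
  - intros c Hc. apply profile_is_derive. lra.
  - intros c Hc.
    assert (H := profile_derive_num_neg c ltac:(lra)).
    apply Ropp_lt_cancel. rewrite Ropp_0, <- Rdiv_opp_l.
    apply Rdiv_lt_0_compat; [lra|apply pow_lt; lra].
Qed.

Lemma profile_PI2 : profile (PI / 2) = 8 * p1.
Proof.
  unfold profile, p1. rewrite sin_PI2, cos_PI2.
  pose proof PI_RGT_0. field. lra.
Qed.

(** By the Taylor bounds [x - x^3/6 <= sin x] and [cos x <= 1 - x^2/2 + x^4/24].
    This shows that [profile] tends to at least 1/3 at 0. *)
Lemma profile_near_0 (x : R) : 0 < x <= 1 -> 1 / 3 - x ^ 2 / 24 <= profile x.
Proof.
  intros Hx.
  destruct (pre_sin_bound x 0) as [Hs _]; [lra|lra|].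
  destruct (pre_cos_bound x 0) as [_ Hc]; [lra|lra|].
  unfold sin_approx, sin_term in Hs. unfold cos_approx, cos_term in Hc.
  simpl in Hs, Hc.
  apply (Rmult_le_compat_l x) in Hc; [|lra].
  unfold profile. apply (Rmult_le_reg_r (x ^ 3)); [apply pow_lt; lra|].
  replace ((sin x - x * cos x) / x ^ 3 * x ^ 3) with (sin x - x * cos x)
    by (field; lra).
  lra.
Qed.

Lemma phi2_is_derive (p x : R) :
  0 < x -> is_derive (phi2 p) x (x * (8 * p - profile x)).
Proof.
  intros Hx. unfold phi2. pose proof PI_RGT_0. auto_derive.
  - repeat split; lra.
  - unfold profile. field. lra.
Qed.

Lemma phi2_decr (p x y : R) :
  0 < x -> x < y -> y < PI -> 8 * p <= profile y -> phi2 p y < phi2 p x.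
Proof.
  intros Hx Hxy Hy Hp.
  apply (gt_of_derive_neg (phi2 p) (fun x => x * (8 * p - profile x))); [lra| |].
  - intros c Hc. apply phi2_is_derive. lra.
  - intros c Hc.
    assert (profile y < profile c) by (apply profile_decr; lra).
    assert (0 < c * (profile c - 8 * p)) by (apply Rmult_lt_0_compat; lra).
    lra.
Qed.

Lemma phi2_incr (p x y : R) :
  0 < x -> x < y -> y < PI -> profile x <= 8 * p -> phi2 p x < phi2 p y.
Proof.
  intros Hx Hxy Hy Hp.
  apply (lt_of_derive_pos (phi2 p) (fun x => x * (8 * p - profile x))); [lra| |].
  - intros c Hc. apply phi2_is_derive. lra.
  - intros c Hc.
    assert (profile c < profile x) by (apply profile_decr; lra).
    apply Rmult_lt_0_compat; lra.
Qed.

Lemma phi2_PI2 (p : R) : phi2 p (PI / 2) = 0.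
Proof.
  unfold phi2. rewrite sin_PI2. pose proof PI_RGT_0. field. lra.
Qed.

Lemma phi2_decr_param (p q x : R) :
  0 < x < PI / 2 -> p < q -> phi2 q x < phi2 p x.
Proof.
  intros Hx Hpq. unfold phi2.
  assert (0 < (q - p) * ((PI - 2 * x) * (PI + 2 * x))).
  { repeat apply Rmult_lt_0_compat; lra. }
  lra.
Qed.

(** * The limit at 0 *)

Definition boundary (p : R) : R := 1 - 2 / PI - p * PI ^ 2.

Lemma boundary_eq (p : R) : boundary p = PI ^ 2 * (p2 - p).
Proof.
  unfold boundary, p2. pose proof PI_RGT_0. field. lra.
Qed.

Lemma boundary_decr (p q : R) : p < q -> boundary q < boundary p.
Proof.
  intros Hpq. unfold boundary.
  assert (0 < (q - p) * PI ^ 2); [|lra].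
  apply Rmult_lt_0_compat; [lra|apply pow_lt, PI_RGT_0].
Qed.

Lemma boundary_pos (p : R) : p < p2 -> 0 < boundary p.
Proof.
  intros Hp. rewrite boundary_eq.
  apply Rmult_lt_0_compat; [apply pow_lt, PI_RGT_0|lra].
Qed.

Lemma phi2_right_lim (p : R) : is_right_lim (phi2 p) 0 (boundary p).
Proof.
  assert (H : is_lim (phi2 p) 0 (boundary p)).
  { apply (is_lim_ext (fun x => sin x / x + (- (2 / PI) - p * (PI ^ 2 - 4 * x ^ 2)))).
    { intros x. unfold phi2. ring. }
    replace (boundary p) with (1 + (- (2 / PI) - p * (PI ^ 2 - 4 * 0 ^ 2)))
      by (unfold boundary; ring).
    apply is_lim_plus'; [exact is_lim_sinc_0|].
    apply (is_lim_continuity (fun x => - (2 / PI) - p * (PI ^ 2 - 4 * x ^ 2))).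
    apply derivable_continuous_pt.
    eexists. apply is_derive_Reals. auto_derive; [trivial|reflexivity]. }
  intros P HP. destruct (H P HP) as [e He]. exists e.
  intros y Hy Hlt. apply He; [exact Hy|lra].
Qed.

(** * The shape of the error function *)

Definition critical (p m : R) : Prop := 0 < m < PI / 2 /\ profile m = 8 * p.

Lemma phi2_decr_before (p m x y : R) :
  critical p m -> 0 < x -> x < y -> y <= m -> phi2 p y < phi2 p x.
Proof.
  intros Hm Hx Hxy Hy. destruct (Hm) as [m_range m_crit].
  apply phi2_decr; try lra.
  destruct Hy as [Hy|Hy]; [|subst; lra].
  assert (profile m < profile y) by (apply profile_decr; lra). lra.
Qed.

Lemma phi2_incr_after (p m x y : R) :
  critical p m -> m <= x -> x < y -> y <= PI / 2 -> phi2 p x < phi2 p y.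
Proof.
  intros Hm Hx Hxy Hy. destruct (Hm) as [m_range m_crit].
  apply phi2_incr; try lra.
  destruct Hx as [Hx|Hx]; [|subst; lra].
  assert (profile x < profile m) by (apply profile_decr; lra). lra.
Qed.

Lemma phi2_ge_min (p m x : R) :
  critical p m -> 0 < x <= PI / 2 -> phi2 p m <= phi2 p x.
Proof.
  intros Hm Hx. destruct (Hm) as [m_range m_crit].
  destruct (Rtotal_order x m) as [H|[H|H]].
  - left. apply (phi2_decr_before p m); auto; lra.
  - subst; lra.
  - left. apply (phi2_incr_after p m); auto; lra.
Qed.

Lemma phi2_neg_after (p m x : R) :
  critical p m -> m <= x < PI / 2 -> phi2 p x < 0.
Proof.
  intros Hm Hx. destruct (Hm) as [m_range m_crit].
  rewrite <- (phi2_PI2 p). apply (phi2_incr_after p m); auto; lra.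
Qed.

Lemma phi2_lt_boundary (p m x : R) :
  critical p m -> 0 < x <= m -> phi2 p x < boundary p.
Proof.
  intros Hm Hx. destruct (Hm) as [m_range m_crit].
  apply Rnot_le_lt. intros Hle.
  (* Half way to 0 the function already exceeds its limit at 0, and it
     increases further towards 0. *)
  assert (Hh : phi2 p x < phi2 p (x / 2))
    by (apply (phi2_decr_before p m); auto; lra).
  destruct (right_lim_witness (phi2 p) (boundary p) (x / 2)
              (fun v => v < phi2 p (x / 2))) as [y [Hy Hlt]].
  - apply phi2_right_lim.
  - lra.
  - apply open_lt. lra.
  - assert (phi2 p (x / 2) < phi2 p y)
      by (apply (phi2_decr_before p m); auto; lra). lra.
Qed.

Lemma phi2_local_min_iff (p m x : R) :
  critical p m -> 0 < x < PI / 2 -> (is_local_min (phi2 p) x <-> x = m).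
Proof.
  intros Hm Hx. destruct (Hm) as [m_range m_crit]. split.
  - intros [e He]. pose proof (cond_pos e).
    destruct (Rtotal_order x m) as [H0|[H0|H0]]; [|exact H0|]; exfalso.
    + set (y := Rmin m (x + e / 2)).
      assert (y <= m) by apply Rmin_l.
      assert (y <= x + e / 2) by apply Rmin_r.
      assert (x < y) by (apply Rmin_glb_lt; lra).
      assert (phi2 p y < phi2 p x) by (apply (phi2_decr_before p m); auto; lra).
      assert (phi2 p x <= phi2 p y); [|lra].
      apply He. change (Rabs (y - x) < e). rewrite Rabs_right; lra.
    + set (y := Rmax m (x - e / 2)).
      assert (m <= y) by apply Rmax_l.
      assert (x - e / 2 <= y) by apply Rmax_r.
      assert (y < x) by (apply Rmax_lub_lt; lra).
      assert (phi2 p y < phi2 p x) by (apply (phi2_incr_after p m); auto; lra).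
      assert (phi2 p x <= phi2 p y); [|lra].
      apply He. change (Rabs (y - x) < e). rewrite Rabs_left; lra.
  - intros ->.
    unfold is_local_min.
    apply (filter_imp (fun y => 0 < y /\ y < PI / 2)).
    + intros y Hy. apply (phi2_ge_min p m); auto; lra.
    + apply (open_and (fun y => 0 < y) (fun y => y < PI / 2));
        [apply open_gt|apply open_lt|lra].
Qed.

Lemma phi2_unique_zero (p m : R) :
  critical p m ->
  p < p2 ->
  exists x0, 0 < x0 < m /\ phi2 p x0 = 0 /\
    (forall x, 0 < x < x0 -> 0 < phi2 p x) /\
    (forall x, x0 < x < PI / 2 -> phi2 p x < 0).
Proof.
  intros Hm Hp. destruct (Hm) as [m_range m_crit].
  destruct (right_lim_witness (phi2 p) (boundary p) m (fun v => 0 < v))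
    as [y [Hy Hpos]].
  { apply phi2_right_lim. }
  { lra. }
  { apply open_gt. now apply boundary_pos. }
  assert (Hneg : phi2 p m < 0) by (apply (phi2_neg_after p m); auto; lra).
  destruct (IVT_derive (fun x => - phi2 p x) (fun x => - (x * (8 * p - profile x))) y m)
    as [x0 [Hx0 Hz]]; try lra.
  { intros c Hc. apply (is_derive_opp (phi2 p)). apply phi2_is_derive. lra. }
  assert (x0 <> m) by (intros ->; lra).
  exists x0. split; [lra|]. split; [lra|]. split.
  - intros x Hx.
    assert (phi2 p x0 < phi2 p x) by (apply (phi2_decr_before p m); auto; lra). lra.
  - intros x Hx. destruct (Rle_lt_dec m x) as [H0|H0].
    + apply (phi2_neg_after p m); auto; lra.
    + assert (phi2 p x < phi2 p x0)
        by (apply (phi2_decr_before p m); auto; lra). lra.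
Qed.

(** * Numerical bounds *)

(** The factorials must be split into products before they are evaluated: as
    unary numbers they would be too large to compute. *)
Ltac expand_taylor :=
  unfold sin_approx, cos_approx, sin_term, cos_term;
  cbn [sum_f_R0 Nat.mul Nat.add];
  rewrite ?fact_simpl, ?mult_INR; cbn [Factorial.fact];
  rewrite ?INR_IZR_INZ; cbn [Z.of_nat Pos.of_succ_nat Pos.succ].

(** PI/2 is the first positive zero of the cosine, so the signs of its Taylor
    bounds at two decimals enclose PI/2. *)
Lemma PI_bounds : 3.14159265358 < PI < 3.1415926536.
Proof.
  pose proof PI_RGT_0. pose proof PI2_1.
  split; apply Rnot_le_lt; intro Hle.
  - assert (0 < cos 1.57079632679).
    { destruct (pre_cos_bound 1.57079632679 4) as [Hc _]; [lra|lra|].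
      revert Hc. expand_taylor. lra. }
    assert (cos 1.57079632679 <= cos (PI / 2)) by (apply cos_decr_1; lra).
    rewrite cos_PI2 in *. lra.
  - assert (cos 1.5707963268 < 0).
    { destruct (pre_cos_bound 1.5707963268 4) as [_ Hc]; [lra|lra|].
      revert Hc. expand_taylor. lra. }
    assert (cos (PI / 2) <= cos 1.5707963268) by (apply cos_decr_1; lra).
    rewrite cos_PI2 in *. lra.
Qed.

Lemma PI_sqr_bounds : 9.869604401 < PI ^ 2 < 9.8696044012.
Proof. pose proof PI_bounds. nra. Qed.

Lemma PI_inv_bounds : 0.318309886182 < / PI < 0.318309886186.
Proof.
  pose proof PI_bounds.
  assert (/ 3.1415926536 < / PI) by (apply Rinv_0_lt_contravar; lra).
  assert (/ PI < / 3.14159265358) by (apply Rinv_0_lt_contravar; lra).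
  lra.
Qed.

Lemma PI_inv_pow_bounds :
  0.10132118364 < (/ PI) ^ 2 < 0.10132118365 /\
  0.03225153443 < (/ PI) ^ 3 < 0.03225153444.
Proof.
  pose proof PI_inv_bounds as [H1 H2].
  assert (0.10132118364 < (/ PI) ^ 2 < 0.10132118365) by (split; nra).
  split; [assumption|].
  replace ((/ PI) ^ 3) with ((/ PI) ^ 2 * / PI) by ring. split; nra.
Qed.

Lemma p1_eq : p1 = (/ PI) ^ 3.
Proof. unfold p1. pose proof PI_RGT_0. field. lra. Qed.

Lemma p2_eq : p2 = (/ PI) ^ 2 - 2 * (/ PI) ^ 3.
Proof. unfold p2. pose proof PI_RGT_0. field. lra. Qed.

Lemma p1_bounds : 0.032251534 < p1 < 0.032251535.
Proof. rewrite p1_eq. pose proof PI_inv_pow_bounds. lra. Qed.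

Lemma p2_bounds : 0.036818114 < p2 < 0.036818115.
Proof. rewrite p2_eq. pose proof PI_inv_pow_bounds. lra. Qed.

(** The endpoints 1.1947015 and 1.194702 enclose the minimum point
    1.19470177... of the minimax approximant, tightly enough to fix the stated
    digits of [p0] and [d0]. *)
Lemma sin_cos_left :
  0.93010605933 < sin 1.1947015 < 0.93010605934 /\
  0.36729105404 < cos 1.1947015 < 0.36729105405.
Proof.
  destruct (pre_sin_bound 1.1947015 3) as [H1 H2]; [lra|lra|].
  destruct (pre_cos_bound 1.1947015 3) as [H3 H4]; [lra|lra|].
  revert H1 H2 H3 H4. expand_taylor. lra.
Qed.

Lemma sin_cos_right :
  0.93010624298 < sin 1.194702 < 0.93010624299 /\
  0.36729058899 < cos 1.194702 < 0.36729058900.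
Proof.
  destruct (pre_sin_bound 1.194702 3) as [H1 H2]; [lra|lra|].
  destruct (pre_cos_bound 1.194702 3) as [H3 H4]; [lra|lra|].
  revert H1 H2 H3 H4. expand_taylor. lra.
Qed.

Lemma profile_left : 8 * 0.0360148077 < profile 1.1947015 < 8 * 0.0360148079.
Proof. pose proof sin_cos_left. unfold profile. lra. Qed.

Lemma profile_right : 8 * 0.0360148032 < profile 1.194702 < 8 * 0.0360148034.
Proof. pose proof sin_cos_right. unfold profile. lra. Qed.

(** Limit at 0 plus minimum value, for the parameter whose minimum point is
    [a]. *)
Definition balance (a : R) : R :=
  boundary (profile a / 8) + phi2 (profile a / 8) a.

Lemma balance_left : balance 1.1947015 < 0.
Proof.
  pose proof sin_cos_left. pose proof profile_left.
  pose proof PI_sqr_bounds. pose proof PI_inv_bounds.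
  unfold balance, boundary, phi2.
  assert (8 * 0.0360148077 * 9.869604401 < profile 1.1947015 * PI ^ 2) by nra.
  lra.
Qed.

Lemma balance_right : 0 < balance 1.194702.
Proof.
  pose proof sin_cos_right. pose proof profile_right.
  pose proof PI_sqr_bounds. pose proof PI_inv_bounds.
  unfold balance, boundary, phi2.
  assert (profile 1.194702 * PI ^ 2 < 8 * 0.0360148034 * 9.8696044012) by nra.
  lra.
Qed.

(** * The minimum point *)

Lemma critical_exists (p : R) : p1 < p < 1 / 24 -> exists m, critical p m.
Proof.
  intros [H1 H2]. pose proof PI2_1.
  (* [profile x >= 1/3 - x^2/24] exceeds [8 * p] once [x^2 < 8 - 192 * p], and
     [x <= 1] gives [x^2 <= x]. *)
  set (x := Rmin 1 (4 - 96 * p)).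
  assert (x <= 1) by apply Rmin_l.
  assert (x <= 4 - 96 * p) by apply Rmin_r.
  assert (0 < x) by (apply Rmin_glb_lt; lra).
  assert (x ^ 2 <= x) by nra.
  pose proof (profile_near_0 x ltac:(lra)) as Hx.
  pose proof profile_PI2.
  destruct (IVT_derive (fun x => 8 * p - profile x)
     (fun x => 0 - ((x ^ 2 - 3) * sin x + 3 * x * cos x) / x ^ 4) x (PI / 2))
    as [m [Hm Hz]]; try lra.
  { intros c Hc.
    apply (is_derive_minus (fun _ => 8 * p) profile); [apply @is_derive_const|].
    apply profile_is_derive. lra. }
  exists m. split; [|lra].
  assert (m <> PI / 2) by (intros ->; lra). lra.
Qed.

Lemma critical_unique (p m n : R) : critical p m -> critical p n -> m = n.
Proof.
  intros [Hm Em] [Hn En].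
  destruct (Rtotal_order m n) as [H|[H|H]]; [|exact H|];
    [assert (profile n < profile m) by (apply profile_decr; lra)
    |assert (profile m < profile n) by (apply profile_decr; lra)]; lra.
Qed.

Definition argmin (p : R) : R := epsilon (inhabits 0) (critical p).

Lemma argmin_critical (p : R) : p1 < p <= p2 -> critical p (argmin p).
Proof.
  intros Hp. unfold argmin. apply epsilon_spec. apply critical_exists.
  pose proof p2_bounds. lra.
Qed.

(** * The equioscillating parameter *)

Lemma balance_is_derive (a : R) : 0 < a -> exists l, is_derive balance a l.
Proof.
  intros Ha. pose proof PI_RGT_0.
  assert (a ^ 3 <> 0) by (apply pow_nonzero; lra).
  unfold balance, boundary, phi2, profile. eexists. auto_derive.
  - repeat split; try assumption; lra.
  - reflexivity.
Qed.

Lemma balance_zero : exists a, 1.1947015 < a < 1.194702 /\ balance a = 0.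
Proof.
  pose proof balance_left. pose proof balance_right.
  destruct (IVT_derive balance (Derive balance) 1.1947015 1.194702)
    as [a [Ha Hz]]; try lra.
  { intros c Hc. apply Derive_correct.
    destruct (balance_is_derive c) as [l Hl]; [lra|]. now exists l. }
  exists a. split; [|exact Hz].
  assert (a <> 1.1947015) by (intros ->; lra).
  assert (a <> 1.194702) by (intros ->; lra). lra.
Qed.

Lemma equioscillation :
  exists p0 a0, critical p0 a0 /\ 0.0360148032 < p0 < 0.0360148079 /\
    boundary p0 = - phi2 p0 a0.
Proof.
  destruct balance_zero as [a [Ha Hz]].
  exists (profile a / 8), a.
  pose proof PI_bounds. pose proof profile_left. pose proof profile_right.
  assert (profile a < profile 1.1947015) by (apply profile_decr; lra).
  assert (profile 1.194702 < profile a) by (apply profile_decr; lra).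
  unfold balance in Hz. unfold critical. repeat split; lra.
Qed.

(** Both summands decrease: the second because
    [phi2 q n <= phi2 q m < phi2 p m]. *)
Lemma boundary_plus_min_decr (p q m n : R) :
  critical p m -> critical q n -> p < q ->
  boundary q + phi2 q n < boundary p + phi2 p m.
Proof.
  intros Hm Hn Hpq.
  pose proof (proj1 Hm).
  assert (boundary q < boundary p) by now apply boundary_decr.
  assert (phi2 q n <= phi2 q m) by (apply (phi2_ge_min q n); auto; lra).
  assert (phi2 q m < phi2 p m) by now apply phi2_decr_param.
  lra.
Qed.

(** * The minimax property *)

Lemma sup_error_ge (p x : R) :
  0 < x < PI / 2 -> Rbar_le (Rabs (phi2 p x)) (sup_error phi2 0 (PI / 2) p).
Proof.
  intros Hx. unfold sup_error.
  apply (proj1 (Lub_Rbar_correct _)). now exists x.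
Qed.

(** The supremum is approached at 0, where it need not be attained: hence the
    intermediate point [v] between [b] and the limit. *)
Lemma sup_error_gt_boundary (p b : R) :
  b < boundary p -> Rbar_lt b (sup_error phi2 0 (PI / 2) p).
Proof.
  intros Hb. set (v := (b + boundary p) / 2).
  pose proof PI_RGT_0.
  destruct (right_lim_witness (phi2 p) (boundary p) (PI / 2) (fun y => v < y))
    as [x [Hx Hv]].
  { apply phi2_right_lim. }
  { lra. }
  { apply open_gt. unfold v. lra. }
  eapply Rbar_lt_le_trans; [|apply (sup_error_ge p x Hx)].
  simpl. pose proof (Rle_abs (phi2 p x)). unfold v in *. lra.
Qed.

Lemma sup_error_equioscillation (p m : R) :
  critical p m -> boundary p = - phi2 p m ->
  sup_error phi2 0 (PI / 2) p = boundary p.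
Proof.
  intros Hm Heq. pose proof (proj1 Hm) as Hr.
  assert (phi2 p m < 0) by (apply (phi2_neg_after p m); auto; lra).
  apply is_lub_Rbar_unique. split.
  - intros y [x [Hx ->]]. simpl. apply Rabs_le. split.
    + assert (phi2 p m <= phi2 p x) by (apply (phi2_ge_min p m); auto; lra). lra.
    + destruct (Rle_lt_dec m x).
      * assert (phi2 p x < 0) by (apply (phi2_neg_after p m); auto; lra). lra.
      * left. apply (phi2_lt_boundary p m); auto; lra.
  - intros b Hb. apply Hb. exists m. split; [exact Hr|].
    rewrite Rabs_left; lra.
Qed.

Lemma sup_error_gt (p q m : R) :
  critical p m -> boundary p = - phi2 p m -> q <> p ->
  Rbar_lt (boundary p) (sup_error phi2 0 (PI / 2) q).
Proof.
  intros Hm Heq Hq. pose proof (proj1 Hm) as Hr.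
  destruct (Rtotal_order q p) as [H|[H|H]]; [|contradiction|].
  - apply sup_error_gt_boundary. now apply boundary_decr.
  - eapply Rbar_lt_le_trans; [|apply (sup_error_ge q m Hr)].
    assert (phi2 q m < phi2 p m) by now apply phi2_decr_param.
    simpl. pose proof (Rabs_maj2 (phi2 q m)). lra.
Qed.

Lemma inf_sup_error_eq (p m : R) :
  0 < p -> critical p m -> boundary p = - phi2 p m ->
  inf_sup_error phi2 0 (PI / 2) = boundary p.
Proof.
  intros Hp Hm Heq.
  apply Rbar_is_glb_unique. split.
  - intros e [q [_ ->]].
    destruct (Req_dec q p) as [->|Hq].
    + rewrite (sup_error_equioscillation p m Hm Heq). apply Rbar_le_refl.
    + apply Rbar_lt_le. now apply (sup_error_gt p q m).
  - intros b Hb. apply Hb. exists p. split; [exact Hp|].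
    now rewrite (sup_error_equioscillation p m Hm Heq).
Qed.

Lemma minimax_iff (p m q : R) :
  0 < p -> critical p m -> boundary p = - phi2 p m ->
  (is_minimax_approximant phi2 0 (PI / 2) q <-> q = p).
Proof.
  intros Hp Hm Heq. unfold is_minimax_approximant.
  rewrite (inf_sup_error_eq p m Hp Hm Heq). split.
  - intros [_ Hs]. destruct (Req_dec q p) as [|Hq]; [assumption|exfalso].
    pose proof (sup_error_gt p q m Hm Heq Hq) as Hlt.
    rewrite Hs in Hlt. simpl in Hlt. lra.
  - intros ->. split; [exact Hp|]. now apply (sup_error_equioscillation p m).
Qed.

Theorem mainTheorem5 :
  (* numerical values of p1 and p2 *)
  (0.032251 <= p1 < 0.032252 /\ 0.036818 <= p2 < 0.036819) /\
  (* (i) *)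
  (forall p, 0 < p <= p1 ->
     forall x, 0 < x < PI / 2 ->
       sin x / x > 2 / PI + p1 * (PI ^ 2 - 4 * x ^ 2) /\
       2 / PI + p1 * (PI ^ 2 - 4 * x ^ 2) >= 2 / PI + p * (PI ^ 2 - 4 * x ^ 2)) /\
  (* (ii) *)
  (forall p, p1 < p < p2 ->
     exists x0, 0 < x0 < PI / 2 /\
       (forall x, 0 < x < PI / 2 -> (phi2 p x = 0 <-> x = x0)) /\
       (forall x, 0 < x < x0 ->
          sin x / x > 2 / PI + p * (PI ^ 2 - 4 * x ^ 2)) /\
       (forall x, x0 < x < PI / 2 ->
          sin x / x < 2 / PI + p * (PI ^ 2 - 4 * x ^ 2))) /\
  (* (iii) *)
  (forall p, p2 <= p ->
     forall x, 0 < x < PI / 2 ->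
       sin x / x < 2 / PI + p2 * (PI ^ 2 - 4 * x ^ 2) /\
       2 / PI + p2 * (PI ^ 2 - 4 * x ^ 2) <= 2 / PI + p * (PI ^ 2 - 4 * x ^ 2)) /\
  (* (iv), with m p the minimum point *)
  (exists m : R -> R,
     (forall p, p1 < p <= p2 ->
        0 < m p < PI / 2 /\
        (forall x, 0 < x < PI / 2 -> (is_local_min (phi2 p) x <-> x = m p))) /\
     (* (v), with L p the value phi_{p,2}(0+) *)
     exists L : R -> R,
       (forall p, 0 < p -> is_right_lim (phi2 p) 0 (L p)) /\
       exists p0 d0 : R,
         p1 < p0 < p2 /\
         (forall p, p1 < p < p2 ->
            (Rabs (L p) = Rabs (phi2 p (m p)) <-> p = p0)) /\
         0.036014 <= p0 < 0.036015 /\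
         d0 = Rabs (L p0) /\
         d0 = Rabs (phi2 p0 (m p0)) /\
         0.0079283 <= d0 < 0.0079284 /\
         Finite d0 = inf_sup_error phi2 0 (PI / 2) /\
         (forall p, is_minimax_approximant phi2 0 (PI / 2) p <-> p = p0)).
Proof.
  pose proof p1_bounds as Hp1. pose proof p2_bounds as Hp2.
  pose proof PI_bounds as Hpi.
  (* Monotonicity in [p] of the right-hand sides in (i) and (iii). *)
  assert (Hpar : forall p q x, 0 < x < PI / 2 -> p <= q ->
            2 / PI + p * (PI ^ 2 - 4 * x ^ 2) <= 2 / PI + q * (PI ^ 2 - 4 * x ^ 2)).
  { intros p q x Hx [Hpq| ->]; [|lra].
    pose proof (phi2_decr_param p q x Hx Hpq). unfold phi2 in *. lra. }
  split; [lra|]. split; [|split; [|split]].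
  - intros p Hp x Hx. split.
    + assert (H : phi2 p1 (PI / 2) < phi2 p1 x).
      { apply phi2_decr; try lra. rewrite profile_PI2. lra. }
      rewrite phi2_PI2 in H. unfold phi2 in H. lra.
    + apply Rle_ge. apply Hpar; [exact Hx|lra].
  - intros p Hp.
    pose proof (argmin_critical p ltac:(lra)) as Hm.
    destruct (phi2_unique_zero p _ Hm) as [x0 [Hx0 [Hz [Hl Hr]]]]; [lra|].
    pose proof (proj1 Hm).
    exists x0. repeat split; try lra.
    + intros Hzx. destruct (Rtotal_order x x0) as [E|[E|E]]; [|exact E|].
      * pose proof (Hl x ltac:(lra)). lra.
      * pose proof (Hr x ltac:(lra)). lra.
    + now intros ->.
    + intros x Hx. specialize (Hl x Hx). unfold phi2 in Hl. lra.
    + intros x Hx. specialize (Hr x Hx). unfold phi2 in Hr. lra.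
  - intros p Hp x Hx. split; [|apply Hpar; assumption].
    pose proof (argmin_critical p2 ltac:(lra)) as Hm.
    assert (H : phi2 p2 x < 0).
    { destruct (Rle_lt_dec (argmin p2) x).
      - apply (phi2_neg_after p2 (argmin p2)); auto; lra.
      - replace 0 with (boundary p2) by (rewrite boundary_eq; ring).
        apply (phi2_lt_boundary p2 (argmin p2)); auto; lra. }
    unfold phi2 in H. lra.
  - exists argmin. split.
    { intros p Hp. pose proof (argmin_critical p Hp) as Hm.
      split; [apply Hm|]. intros x Hx. now apply phi2_local_min_iff. }
    exists boundary. split; [intros p _; apply phi2_right_lim|].
    destruct equioscillation as [p0 [a0 [Ha [Hp0 Heq]]]].
    pose proof (argmin_critical p0 ltac:(lra)) as Hm.
    rewrite (critical_unique p0 a0 (argmin p0) Ha Hm) in Heq.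
    assert (Habs : forall p, p1 < p < p2 ->
              Rabs (boundary p) = boundary p /\
              Rabs (phi2 p (argmin p)) = - phi2 p (argmin p)).
    { intros p Hp. pose proof (argmin_critical p ltac:(lra)) as Hmp.
      pose proof (proj1 Hmp).
      pose proof (boundary_pos p ltac:(lra)).
      pose proof (phi2_neg_after p _ (argmin p) Hmp ltac:(lra)).
      split; [apply Rabs_right|apply Rabs_left]; lra. }
    destruct (Habs p0 ltac:(lra)) as [HL HM].
    exists p0, (boundary p0).
    split; [lra|]. split; [|split; [lra|split; [lra|split; [lra|split; [|split]]]]].
    + intros p Hp. destruct (Habs p Hp) as [-> ->].
      pose proof (argmin_critical p ltac:(lra)) as Hmp.
      split; [|intros ->; exact Heq].
      intros Hbal. destruct (Rtotal_order p p0) as [H|[H|H]]; [|exact H|].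
      * pose proof (boundary_plus_min_decr p p0 _ _ Hmp Hm H). lra.
      * pose proof (boundary_plus_min_decr p0 p _ _ Hm Hmp H). lra.
    + pose proof PI_sqr_bounds. pose proof PI_inv_bounds.
      assert (0.0360148032 * 9.869604401 < p0 * PI ^ 2 < 0.0360148079 * 9.8696044012)
        by (split; nra).
      unfold boundary. lra.
    + symmetry. apply (inf_sup_error_eq p0 (argmin p0)); auto; lra.
    + intros p. apply (minimax_iff p0 (argmin p0)); auto; lra.
Qed.
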